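(* Let $\mathcal{F}=\{w_1,\dots,w_N\}$ be a topologically contractive IFS (TIFS) on a nonempty Hausdorff topological space $X$, and let $I=\{1,\dots,N\}$. Then there is a map $\pi:I^\infty\to X$ such that: (i) $\pi$ is a coding map, i.e. $\pi$ is continuous and $w_i\circ\pi=\pi\circ\tau_i$ for every $i\in I$; (ii) the set $\pi(I^\infty)$ is the attractor of $\mathcal{F}$; (iii) for every $\alpha\in I^\infty$ and every $C\in\mathcal{K}(X)$ with $\mathcal{F}(C)\subseteq C$, the point $\pi(\alpha)$ is the only element of $\bigcap_{k\in\mathbb{N}}w_{\alpha_{|k}}(C)$; (iv) for every $K\in\mathcal{K}(X)$ and $\alpha\in I^\infty$, the sequence $(w_{\alpha_{|k}}(K))_k$ converges to $\{\pi(\alpha)\}$ in the Vietoris topology; (v) $\pi(I^\infty)$ is the closure of the set of all fixed points of the maps $w_\alpha$, where $\alpha$ ranges over all nonempty finite words over $I$; (vi) $\pi(I^\infty)$ is metrizable.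
   Context: $\mathcal{K}(X)$ is the set of nonempty compact subsets of $X$, with the Vietoris topology, whose subbase consists of the sets $\{K:K\subseteq V\}$ and $\{K:K\cap V\ne\emptyset\}$ for $V\subseteq X$ open. For a finite family $\mathcal{F}=\{w_1,\dots,w_N\}$ of continuous selfmaps of $X$ the Hutchinson operator is $\mathcal{F}(K)=\bigcup_{i=1}^N w_i(K)$ for $K\in\mathcal{K}(X)$. $I^\infty$ is the space of infinite sequences over $I$ with the product topology ($I$ discrete); $\tau_i(\alpha_1,\alpha_2,\dots)=(i,\alpha_1,\alpha_2,\dots)$. For a finite word $\alpha=(\alpha_1,\dots,\alpha_k)$, $w_\alpha=w_{\alpha_1}\circ\cdots\circ w_{\alpha_k}$; for $\alpha\in I^\infty$, $\alpha_{|k}=(\alpha_1,\dots,\alpha_k)$. $\mathcal{F}$ is a topologically contractive IFS (TIFS) if all $w_i$ are continuous and: (1) for every $K\in\mathcal{K}(X)$ there is $C\in\mathcal{K}(X)$ with $K\subseteq C$ and $\mathcal{F}(C)\subseteq C$; (2) for every $C\in\mathcal{K}(X)$ with $\mathcal{F}(C)\subseteq C$ and every $\alpha\in I^\infty$, the set $\bigcap_{k\in\mathbb{N}}w_{\alpha_{|k}}(C)$ is a singleton. An attractor of $\mathcal{F}$ is a set $A\in\mathcal{K}(X)$ with $\mathcal{F}(A)=A$ such that $\mathcal{F}^k(K)\to A$ in the Vietoris topology for every $K\in\mathcal{K}(X)$ (it is unique if it exists). *)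

(* Defs.v *)
From HB Require Import structures.
From mathcomp Require Import all_boot all_order all_algebra.
From mathcomp Require Import all_classical all_reals all_analysis.

Set Implicit Arguments.
Unset Strict Implicit.
Unset Printing Implicit Defensive.

Import Order.TTheory GRing.Theory Num.Theory.
Local Open Scope classical_set_scope.

Record hyperspace (X : topologicalType) := Hyperspace {
  hset :> set X;
  hset_compact : compact hset;
  hset_neq0 : hset !=set0
}.

HB.instance Definition _ (X : topologicalType) := gen_eqMixin (hyperspace X).
HB.instance Definition _ (X : topologicalType) :=
  gen_choiceMixin (hyperspace X).

Definition vietoris_subbase (X : topologicalType) : set_system (hyperspace X) :=
  [set [set K : hyperspace X | K `<=` V] | V in @open X] `|`
  [set [set K : hyperspace X | K `&` V !=set0] | V in @open X].

HB.instance Definition _ (X : topologicalType) :=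
  isSubBaseTopological.Build (hyperspace X) (@vietoris_subbase X) id.

Lemma compact_image (X Y : topologicalType) (f : continuousType X Y)
  (K : hyperspace X) : compact (f @` K).
Proof.
apply: (continuous_compact _ (@hset_compact _ K)).
by apply: continuous_subspaceT; exact: cts_fun.
Qed.

Lemma image_hset_neq0 (X Y : topologicalType) (f : continuousType X Y)
  (K : hyperspace X) : (f @` K) !=set0.
Proof. by have [x Kx] := @hset_neq0 _ K; exists (f x), x. Qed.

Definition himage (X Y : topologicalType) (f : continuousType X Y)
    (K : hyperspace X) : hyperspace Y :=
  Hyperspace (@compact_image _ _ f K) (image_hset_neq0 f K).

Lemma set1_neq0 (X : topologicalType) (x : X) : [set x] !=set0.
Proof. by exists x. Qed.

Definition hpoint (X : topologicalType) (x : X) : hyperspace X :=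
  Hyperspace (@compact_set1 X x) (set1_neq0 x).

(* A family w_1, ..., w_N with N = n.+1 >= 1 is indexed by 'I_n.+1: for N = 0
   the Hutchinson operator would not map the hyperspace to itself. *)
Lemma compact_hutchinson (X : topologicalType) (n : nat)
  (w : 'I_n.+1 -> continuousType X X) (K : hyperspace X) :
  compact (\bigcup_i (w i @` K)).
Proof.
rewrite (_ : [set: 'I_n.+1] = [set` index_enum 'I_n.+1]); last first.
  by apply/seteqP; split=> i //= _; rewrite mem_index_enum.
by rewrite bigcup_seq; apply: bigsetU_compact => i _; exact: compact_image.
Qed.

Lemma hutchinson_neq0 (X : topologicalType) (n : nat)
  (w : 'I_n.+1 -> continuousType X X) (K : hyperspace X) :
  (\bigcup_i (w i @` K)) !=set0.
Proof. by have [x Kx] := @hset_neq0 _ K; exists (w ord0 x), ord0 => //; exists x. Qed.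

Definition hutchinson (X : topologicalType) (n : nat)
    (w : 'I_n.+1 -> continuousType X X) (K : hyperspace X) : hyperspace X :=
  Hyperspace (@compact_hutchinson _ _ w K) (hutchinson_neq0 w K).

Definition code_space (n : nat) : Type :=
  prod_topology (fun _ : nat => discrete_topology 'I_n.+1).

HB.instance Definition _ (n : nat) := Topological.on (code_space n).

Definition shift_in (n : nat) (i : 'I_n.+1) (alpha : code_space n) :
    code_space n :=
  fun k => if k is k'.+1 then alpha k' else i.

(* Infinite words are indexed from 0 here, so this is (alpha_1, ..., alpha_k). *)
Definition truncation (n : nat) (alpha : code_space n) (k : nat) :
    seq 'I_n.+1 := mkseq alpha k.

Fixpoint word_map (X : topologicalType) (n : nat)
    (w : 'I_n.+1 -> continuousType X X) (s : seq 'I_n.+1) :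
    continuousType X X :=
  if s is i :: s' then w i \o word_map w s' else idfun.

Definition tifs (X : topologicalType) (n : nat)
    (w : 'I_n.+1 -> continuousType X X) : Prop :=
  (forall K : hyperspace X, exists C : hyperspace X,
     K `<=` C /\ hutchinson w C `<=` C) /\
  (forall C : hyperspace X, hutchinson w C `<=` C ->
     forall alpha : code_space n, exists x : X,
       \bigcap_k (word_map w (truncation alpha k) @` C) = [set x]).

Definition is_attractor (X : topologicalType) (n : nat)
    (w : 'I_n.+1 -> continuousType X X) (A : hyperspace X) : Prop :=
  hutchinson w A = A /\
  forall K : hyperspace X, iter k (hutchinson w) K @[k --> \oo] --> A.

Definition metrizable (R : realType) (T : topologicalType) : Prop :=
  exists d : T -> T -> R,
    [/\ forall x y, (0 <= d x y)%R,
        forall x y, d x y = 0%R <-> x = y,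
        forall x y, d x y = d y x,
        forall x y z, (d x z <= d x y + d y z)%R &
        forall x, nbhs x = filter_from [set e | (0 < e)%R]
                                       (fun e => [set y | (d x y < e)%R])].

(* Main.v *)
Require Import Defs.
From HB Require Import structures.
From mathcomp Require Import all_boot all_order all_algebra.
From mathcomp Require Import all_classical all_reals all_analysis.
From mathcomp Require Import lra.

Set Implicit Arguments.
Unset Strict Implicit.
Unset Printing Implicit Defensive.

Import Order.TTheory GRing.Theory Num.Theory.
Import numFieldNormedType.Exports.
Local Open Scope classical_set_scope.

(** For an invariant compact C the sets w_(alpha|k)(C) are compact and decrease
    to {pi alpha}, so they eventually lie in any given neighbourhood of
    [pi alpha]; by compactness of the code space this is uniform in alpha for
    neighbourhoods of the range of [pi].  This gives continuity of [pi] and all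
    the Vietoris limits.  The fixed point of w_s is the image of the periodic
    code s s s ..., and a fixed point stays in infinitely many iterates of the
    Hutchinson operator on its singleton, hence lies in the attractor.  For
    metrizability, the countably many closed sets w_s(A) separate the points of
    the attractor A; Urysohn functions for the disjoint pairs among them then
    form a countable separating family, and a compact space with such a family
    is metrizable. *)

Lemma set_type_hausdorff (X : topologicalType) (A : set X) :
  hausdorff_space X -> hausdorff_space (set_type A).
Proof.
move=> hX p q clpq; apply/val_inj/hX => U V nU nV.
have cval (x : A) (W : set X) : nbhs (\val x) W -> nbhs x (\val @^-1` W).
  exact: (@initial_continuous A X set_val x W).
have [y [Uy Vy]] := clpq _ _ (cval p U nU) (cval q V nV).
by exists (\val y).
Qed.

(** * Metrics from countable separating families of functions *)

Section sup_metric.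
Context (R : realType) (T : topologicalType) (f : nat -> T -> R).
Local Open Scope ring_scope.

(** The weights [1/(k+1)] tend to 0, so up to any positive error only finitely many [f k] matter.
    This lets continuity of each [f k] control the distance. *)
Definition sup_dist (x y : T) : R :=
  sup (range (fun k : nat => `|f k x - f k y| / k.+1%:R)).

Hypothesis f01 : forall k x, 0 <= f k x <= 1.
Hypothesis f_cont : forall k, continuous (f k).
Hypothesis f_sep : forall x y, x <> y -> exists k, f k x <> f k y.

Let dist_le_inv k x y : `|f k x - f k y| / k.+1%:R <= k.+1%:R^-1.
Proof.
rewrite ler_piMl ?invr_ge0//.
have /andP[? ?] := f01 k x; have /andP[? ?] := f01 k y.
by rewrite ler_norml; apply/andP; split; lra.
Qed.

Lemma sup_dist_ge k x y : `|f k x - f k y| / k.+1%:R <= sup_dist x y.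
Proof.
apply: ub_le_sup; last by exists k.
exists 1 => _ [m _ <-]; apply: le_trans (dist_le_inv _ _ _) _.
by rewrite invf_le1// ler1n.
Qed.

Lemma sup_dist_le x y e :
  (forall k, `|f k x - f k y| / k.+1%:R <= e) -> sup_dist x y <= e.
Proof.
move=> le_e; apply: ge_sup; first by exists (`|f 0 x - f 0 y| / 1%:R), 0.
by move=> _ [m _ <-].
Qed.

Lemma sup_dist_ge0 x y : 0 <= sup_dist x y.
Proof. by rewrite (le_trans _ (sup_dist_ge 0 x y))// divr_ge0. Qed.

Lemma sup_dist_eq0 x y : sup_dist x y = 0 <-> x = y.
Proof.
split=> [d0|->]; last first.
  apply/eqP; rewrite eq_le sup_dist_ge0 andbT.
  by apply: sup_dist_le => k; rewrite subrr normr0 mul0r.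
apply: contrapT => /f_sep[k]; apply; apply/eqP; rewrite -subr_eq0 -normr_le0.
by have := sup_dist_ge k x y; rewrite d0 pmulr_lle0// invr_gt0.
Qed.

Lemma sup_distC x y : sup_dist x y = sup_dist y x.
Proof. by rewrite /sup_dist; under eq_fun => k do rewrite distrC. Qed.

Lemma sup_dist_triangle x y z : sup_dist x z <= sup_dist x y + sup_dist y z.
Proof.
apply: sup_dist_le => k.
rewrite (le_trans _ (lerD (sup_dist_ge k _ _) (sup_dist_ge k _ _)))//.
by rewrite -mulrDl ler_wpM2r ?invr_ge0// ler_distD.
Qed.

Lemma nbhs_sup_dist x e : 0 < e -> nbhs x [set y | sup_dist x y < e].
Proof.
move=> e0; have e20 : 0 < e / 2 by rewrite divr_gt0.
have [N _ HN] := near_infty_natSinv_lt (PosNum e20).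
have near_f (k : 'I_N) : \forall y \near x, `|f k x - f k y| < e / 2.
  have /cvgrPdist_lt/(_ _ e20) := @f_cont k x; exact.
have : \forall y \near x, forall k : 'I_N, `|f k x - f k y| < e / 2.
  by apply: filter_forall.
apply: filterS => y near_y /=.
(* Termwise bounds by [e / 2] only give a non-strict bound on the supremum; the other half of [e]
   makes it strict. *)
have {1}-> : e = e / 2 + e / 2 by rewrite -splitr.
rewrite ltr_pwDr//; apply: sup_dist_le => k.
have [kN|Nk] := ltnP k N.
  apply: le_trans (ltW (near_y (Ordinal kN))) => /=.
  by rewrite ler_piMr// invf_le1// ler1n.
exact: le_trans (dist_le_inv _ _ _) (ltW (HN _ Nk)).
Qed.

Lemma sup_dist_continuous x : continuous (sup_dist x).
Proof.
move=> y; apply/cvgrPdist_lt => e e0.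
apply: filterS (nbhs_sup_dist y e0) => z /=; apply: le_lt_trans.
have := sup_dist_triangle x y z; have := sup_dist_triangle x z y.
by rewrite (sup_distC z y) ler_norml => ? ?; apply/andP; split; lra.
Qed.

Hypothesis compactT : compact [set: T].

(** The radius of a ball inside an open [V] around [x] is the minimum of the distance from [x] over
    the compact complement of [V]; it is positive because the minimizer differs from [x]. *)
Lemma compact_sup_dist_metrizable : metrizable R T.
Proof.
exists sup_dist; split; [exact: sup_dist_ge0|exact: sup_dist_eq0|
  exact: sup_distC|exact: sup_dist_triangle|].
move=> x; apply/seteqP; split=> U; last first.
  by move=> [e /= e0] eU; apply: filterS eU _; exact: nbhs_sup_dist.
rewrite nbhsE => -[V [oV Vx] VU].
(* An empty complement has no minimizer, but then any radius works. *)
have [VC0|/set0P VC_neq0] := eqVneq (~` V) set0.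
  exists 1 => //= y _; apply: VU; apply: contrapT => nVy.
  by have : (~` V) y by []; rewrite VC0.
have VC_compact : compact (~` V).
  exact: subclosed_compact (open_closedC oV) compactT _.
have [z Vz zmin] := compact_EVT_min VC_neq0 VC_compact
  (continuous_subspaceT (@sup_dist_continuous x)).
exists (sup_dist x z).
  rewrite /= lt_neqAle sup_dist_ge0 andbT eq_sym; apply/eqP => /sup_dist_eq0 xz.
  by move: Vz; rewrite inE -xz; exact.
move=> y /=; rewrite ltNge => /negP xyz; apply: VU; apply: contrapT => nVy.
by apply/xyz/zmin; rewrite inE.
Qed.

End sup_metric.

Lemma compact_network_metrizable (R : realType) (T : topologicalType)
    (J : countType) (K : J -> set T) :
  compact [set: T] -> hausdorff_space T -> (forall j, closed (K j)) ->
  (forall x y, x <> y -> exists i j, [/\ K i x, K j y & K i `&` K j = set0]) ->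
  metrizable R T.
Proof.
move=> cT hT clK sepK.
(* [Urysohn] is continuous with values in [0, 1] for every pair, so all pairs are enumerated and
   disjointness enters only when separating points. Integers that code no pair get the zero
   function. *)
pose g (p : J * J) : T -> R := Urysohn (K p.1) (K p.2).
pose f k : T -> R := if unpickle k is Some p then g p else (fun=> 0%R).
apply: (@compact_sup_dist_metrizable R T f) => //.
- move=> k x; rewrite /f; case: unpickle => [p|]; last by rewrite lexx ler01.
  have /= := @Urysohn_range T R (K p.1) (K p.2) (g p x); rewrite in_itv.
  by apply; exists x.
- move=> k; rewrite /f; case: unpickle => [p|]; last by move=> x; exact: cvg_cst.
  exact: Urysohn_continuous.
- move=> x y /sepK[i [j [Kix Kjy Kij]]]; exists (pickle (i, j)).
  have sep := (@normal_separatorP R T).1 (compact_normal hT cT) _ _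
    (clK i) (clK j) Kij.
  rewrite /f pickleK /g /=.
  have -> : Urysohn (K i) (K j) x = 0%R :> R.
    by apply: Urysohn_sub0 sep _ _; exists x.
  have -> : Urysohn (K i) (K j) y = 1%R :> R.
    by apply: Urysohn_sub1 sep _ _; exists y.
  by move/esym/eqP; rewrite oner_eq0.
Qed.

(** * Decreasing compact sets and Vietoris convergence *)

(** Each point of [K] either lies in [U] or is excluded by some [C m], hence, [C m] being closed,
    together with a neighbourhood and for all later indices. Compactness makes the index uniform. *)
Lemma compact_sub_open (X : topologicalType) (K U : set X) (C : nat -> set X) :
  compact K -> (forall k, closed (C k)) -> (forall k, C k.+1 `<=` C k) ->
  C 0 `<=` K -> open U -> \bigcap_k C k `<=` U ->
  \forall k \near \oo, C k `<=` U.
Proof.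
move=> /compact_near_coveringP cK clC Cdecr C0K oU CU.
have Cmono : {homo C : k m / (k <= m)%N >-> m `<=` k}.
  move=> k m; elim: m => [|m IH]; first by rewrite leqn0 => /eqP ->.
  rewrite leq_eqVlt => /predU1P[->//|/IH]; exact: subset_trans (Cdecr m).
have : \forall k \near \oo, K `<=` (fun x => C k x -> U x).
  apply: cK => x Kx; have [Ux|nUx] := pselect (U x).
    exists (U, setT) => /=; first by split; [exact: open_nbhs_nbhs|exact: filterT].
    by move=> [y k] /= [].
  have /existsNP[m nCx] : ~ forall k, C k x by move=> Cx; apply/nUx/CU => k _.
  exists (~` C m, [set k | (m <= k)%N]) => /=.
    split; first by apply: open_nbhs_nbhs; split=> //; exact: closed_openC.
    exact: nbhs_infty_ge.
  by move=> [y k] /= [nCy mk] /(Cmono _ _ mk).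
apply: filterS => k KU x Cx; apply: KU => //.
exact/C0K/(Cmono 0 k).
Qed.

(** Basic neighbourhoods are finite intersections of subbasic ones, and filters are stable under
    these, so testing the two kinds of subbasic sets suffices. *)
Lemma vietoris_cvg (X : topologicalType) (F : set_system (hyperspace X))
    (K : hyperspace X) : Filter F ->
  (forall V, open V -> K `<=` V -> F [set L | L `<=` V]) ->
  (forall V, open V -> K `&` V !=set0 -> F [set L | L `&` V !=set0]) ->
  F --> K.
Proof.
move=> FF Fsub Fmeet A /=; rewrite (@nbhsE (hyperspace X)).
move=> [_ [[B sB <-] [C BC CK] sUBA]].
rewrite nbhs_filterE; apply: filterS sUBA _; apply: (@filterS _ _ _ C).
  by move=> ? ?; exists C.
have /sB [D sD IDeC] := BC; rewrite -IDeC; apply: filter_bigI => E DE.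
have EK : E K by move: CK; rewrite -IDeC => /(_ _ DE).
by have /sD := DE; rewrite inE => -[] [V oV VE]; move: EK; rewrite /= -VE;
  [exact: Fsub|exact: Fmeet].
Qed.

(** * Finite words and the code space *)

Section words.
Context (n : nat).
Implicit Types (i : 'I_n.+1) (s t : seq 'I_n.+1) (alpha beta : code_space n).

Definition prepend s alpha : code_space n := foldr (@shift_in n) alpha s.

Definition periodic_word s : code_space n := fun k => nth ord0 s (k %% size s).

Lemma prependE s alpha k :
  prepend s alpha k = if (k < size s)%N then nth ord0 s k else alpha (k - size s)%N.
Proof. by elim: s k => [|i s IH] [|k] //=; rewrite ?subn0// IH ltnS subSS. Qed.

Lemma truncation_prepend s alpha : truncation (prepend s alpha) (size s) = s.
Proof.
apply: (@eq_from_nth _ ord0); rewrite size_mkseq// => k ks.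
by rewrite nth_mkseq// prependE ks.
Qed.

Lemma prepend_periodic s : s <> [::] -> prepend s (periodic_word s) = periodic_word s.
Proof.
move=> s0; apply/funext => k; rewrite prependE /periodic_word.
case: ltnP => [ks|sk]; first by rewrite modn_small.
by rewrite -[in RHS](subnK sk) modnDr.
Qed.

Lemma truncationS alpha k :
  truncation alpha k.+1 = rcons (truncation alpha k) (alpha k).
Proof. exact: mkseqS. Qed.

Lemma truncation_shift_in i alpha k :
  truncation (shift_in i alpha) k.+1 = i :: truncation alpha k.
Proof. by rewrite /truncation /mkseq /= (iotaDl 1 0) -map_comp. Qed.

(** Only finitely many letters are prescribed, and each letter is a continuous map to a discrete
    space. *)
Lemma nbhs_cylinder alpha k :
  nbhs alpha [set beta | truncation beta k = truncation alpha k].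
Proof.
elim: k => [|k IH]; first by apply: filterS filterT.
have near_k : nbhs alpha [set beta | beta k = alpha k].
  exact: (@proj_continuous nat (fun=> discrete_topology 'I_n.+1) k alpha _
    (discrete_set1 (alpha k))).
by apply: filterS2 IH near_k => beta /= e1 e2; rewrite !truncationS e1 e2.
Qed.

Lemma code_space_compact : compact [set: code_space n].
Proof.
have I_compact : compact [set: discrete_topology 'I_n.+1].
  exact/finite_compact/(@finite_finset 'I_n.+1).
have := @tychonoff nat _ _ (fun=> I_compact).
by congr (compact _); apply/seteqP; split.
Qed.

End words.

(** * Word maps and iterates of the Hutchinson operator *)

Section ifs.
Context (X : topologicalType) (n : nat) (w : 'I_n.+1 -> continuousType X X).
Implicit Types (i : 'I_n.+1) (s t : seq 'I_n.+1) (alpha : code_space n).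
Implicit Types (K C : hyperspace X).

Lemma word_map_cat s t x : word_map w (s ++ t) x = word_map w s (word_map w t x).
Proof. by elim: s => //= i s IH; rewrite -IH. Qed.

Lemma hutchinson_image i K x : hset K x -> hset (hutchinson w K) (w i x).
Proof. by move=> Kx; exists i => //; exists x. Qed.

Lemma word_map_invariant C s x : hutchinson w C `<=` C ->
  hset C x -> hset C (word_map w s x).
Proof.
by move=> wC Cx; elim: s => //= i s IH; apply: wC; exact: hutchinson_image.
Qed.

(** The added letter is the innermost map, which sends [C] into itself. *)
Lemma word_map_truncationS C alpha k : hutchinson w C `<=` C ->
  word_map w (truncation alpha k.+1) @` C `<=` word_map w (truncation alpha k) @` C.
Proof.
move=> wC _ [x Cx <-]; rewrite truncationS -cats1 word_map_cat.
by exists (word_map w [:: alpha k] x) => //; exact: word_map_invariant.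
Qed.

Lemma iter_hutchinsonP K k x : hset (iter k (hutchinson w) K) x <->
  exists2 s, size s = k & (word_map w s @` K) x.
Proof.
split.
  elim: k x => [|k IH] x /=; first by exists [::] => //; exists x.
  move=> [i _ [y /IH[s sk [z Kz zy]] <-]].
  by exists (i :: s); [rewrite /= sk|exists z => //=; rewrite -zy].
move=> [s <- [z Kz <-]] {k x}; elim: s => //= i s IH.
exact: (@hutchinson_image i (iter (size s) (hutchinson w) K)).
Qed.

Lemma hset_inj : injective (@hset X).
Proof.
move=> [K cK K0] [C cC C0] /= KC; subst C.
by rewrite (Prop_irrelevance cC cK) (Prop_irrelevance C0 K0).
Qed.

Lemma word_images_sub_open C alpha x V : hausdorff_space X ->
  hutchinson w C `<=` C ->
  \bigcap_k (word_map w (truncation alpha k) @` C) = [set x] ->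
  open V -> V x ->
  \forall k \near \oo, word_map w (truncation alpha k) @` C `<=` V.
Proof.
move=> hX wC Cx oV Vx; apply: (@compact_sub_open X C) => //.
- exact: hset_compact.
- by move=> k; apply: compact_closed => //; exact: compact_image.
- by move=> k; exact: word_map_truncationS.
- by rewrite Cx => _ ->.
Qed.

(* The intersection does not depend on C: two invariant sets sit in a common one,
   whose intersection along the code is a singleton containing both of theirs. *)
Lemma tifs_code : tifs w -> [set: X] !=set0 -> exists pi : code_space n -> X,
  forall alpha C, hutchinson w C `<=` C ->
    \bigcap_k (word_map w (truncation alpha k) @` C) = [set pi alpha].
Proof.
move=> [tifs1 tifs2] [x0 _].
have [C0 [_ wC0]] := tifs1 (hpoint x0).
have [pi piP] := choice (tifs2 _ wC0).
exists pi => alpha C wC.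
have CC0 : compact (C `|` C0) by apply: compactU; exact: hset_compact.
have CC0_neq0 : C `|` C0 !=set0.
  by have [x Cx] := @hset_neq0 _ C; exists x; left.
have [D [CD wD]] := tifs1 (Hyperspace CC0 CC0_neq0).
have [d dP] := tifs2 _ wD alpha.
have cap_sub B : B `<=` D ->
    \bigcap_k (word_map w (truncation alpha k) @` B) `<=` [set d].
  by rewrite -dP => BD x Bx k _; apply: image_subset (Bx k I).
have -> : pi alpha = d.
  by apply: (cap_sub C0); [move=> x ?; apply: CD; right|rewrite piP].
have [c cP] := tifs2 _ wC alpha.
have <- : c = d by apply: (cap_sub C); [move=> x ?; apply: CD; left|rewrite cP].
exact: cP.
Qed.

(** * The coding map *)

Section coding_map.
Hypothesis X_hausdorff : hausdorff_space X.
Hypothesis ex_invariant :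
  forall K, exists C, K `<=` C /\ hutchinson w C `<=` C.
Variable pi : code_space n -> X.
Hypothesis piP : forall alpha C, hutchinson w C `<=` C ->
  \bigcap_k (word_map w (truncation alpha k) @` C) = [set pi alpha].

Lemma code_in_word_image C alpha k : hutchinson w C `<=` C ->
  (word_map w (truncation alpha k) @` C) (pi alpha).
Proof.
by move=> wC; have : [set pi alpha] (pi alpha) by []; rewrite -(piP _ wC); exact.
Qed.

Lemma code_in_invariant C alpha : hutchinson w C `<=` C -> hset C (pi alpha).
Proof. by move=> /(@code_in_word_image C alpha 0)[x Cx <-]. Qed.

Lemma near_word_image_sub C alpha V :
  hutchinson w C `<=` C -> open V -> V (pi alpha) ->
  \forall k \near \oo, word_map w (truncation alpha k) @` C `<=` V.
Proof.
by move=> wC; apply: word_images_sub_open => //; exact: piP.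
Qed.

Lemma code_neighborhood alpha V : open V -> V (pi alpha) ->
  exists C k, hutchinson w C `<=` C /\ word_map w (truncation alpha k) @` C `<=` V.
Proof.
move=> oV Vpi; have [C [_ wC]] := ex_invariant (hpoint (pi alpha)).
have [k _ /(_ k (leqnn k)) CV] := near_word_image_sub wC oV Vpi.
by exists C, k.
Qed.

(** Codes sharing the first [k] letters of [alpha] are sent into the same word image of [C], which
    is inside [V] for a suitable [k]. *)
Lemma code_continuous : continuous pi.
Proof.
move=> alpha U; rewrite nbhsE => -[V [oV Vpi] VU].
have [C [k [wC CV]]] := code_neighborhood oV Vpi.
apply: filterS (nbhs_cylinder alpha k) => beta /= tr_beta.
by apply/VU/CV; rewrite -tr_beta; exact: code_in_word_image.
Qed.

Lemma code_shift_in i alpha : w i (pi alpha) = pi (shift_in i alpha).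
Proof.
have [C [_ wC]] := ex_invariant (hpoint (pi alpha)).
suff : [set pi (shift_in i alpha)] (w i (pi alpha)) by [].
(* For the empty truncation the set is [C] itself; a longer one starts with [i], which factors out
   as [w i]. *)
rewrite -(piP _ wC) => -[|k] _.
  exists (w i (pi alpha)) => //; apply/wC/hutchinson_image.
  exact: code_in_invariant.
rewrite truncation_shift_in; have [y Cy <-] := code_in_word_image alpha k wC.
by exists y.
Qed.

Lemma word_map_code s alpha : word_map w s (pi alpha) = pi (prepend s alpha).
Proof. by elim: s => //= i s ->; exact: code_shift_in. Qed.

(** * The attractor and Vietoris limits *)

Lemma code_range_compact : compact (range pi).
Proof.
apply: continuous_compact; last exact: code_space_compact.
by apply: continuous_subspaceT; exact: code_continuous.
Qed.

Lemma code_range_neq0 : range pi !=set0.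
Proof. by exists (pi (fun=> ord0)), (fun=> ord0). Qed.

Definition code_range : hyperspace X :=
  Hyperspace code_range_compact code_range_neq0.

Lemma code_range_invariant : hutchinson w code_range = code_range.
Proof.
apply/hset_inj/seteqP; split=> [_ [i _ [_ [alpha _ <-] <-]]|_ [alpha _ <-]].
  by exists (shift_in i alpha) => //; rewrite code_shift_in.
have -> : alpha = shift_in (alpha 0) (fun k => alpha k.+1).
  by apply/funext; case.
by rewrite -code_shift_in; apply: hutchinson_image; exists (fun k => alpha k.+1).
Qed.

(** A stage that works for one code works on a whole cylinder and at all later stages, so
    compactness of the code space gives a stage valid for all codes at once. *)
Lemma iter_hutchinson_sub_open K V : open V -> range pi `<=` V ->
  \forall k \near \oo, iter k (hutchinson w) K `<=` V.
Proof.
move=> oV piV; have [C [KC wC]] := ex_invariant K.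
have : \forall k \near \oo, [set: code_space n] `<=`
    (fun alpha => word_map w (truncation alpha k) @` C `<=` V).
  move/compact_near_coveringP: (@code_space_compact n); apply=> alpha _.
  have Vpi : V (pi alpha) by apply: piV; exists alpha.
  have [k _ CV] := near_word_image_sub wC oV Vpi.
  exists ([set beta | truncation beta k = truncation alpha k],
          [set m | (k <= m)%N]) => /=.
    by split; [exact: nbhs_cylinder|exact: nbhs_infty_ge].
  move=> [beta m] /= [tr_beta km]; apply: subset_trans (CV _ (leqnn k)).
  rewrite -tr_beta -(subnKC km); elim: (m - k)%N => [|j IH]; first by rewrite addn0.
  by rewrite addnS; apply: subset_trans IH; exact: word_map_truncationS.
apply: filterS => k CV x /iter_hutchinsonP[s sk [y Ky <-]].
(* Every finite word is a truncation of some code; the tail is arbitrary. *)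
apply: (CV (prepend s (fun=> ord0)) I); rewrite -sk truncation_prepend.
by exists y => //; exact: KC.
Qed.

Lemma code_range_attractor : is_attractor w code_range.
Proof.
split; first exact: code_range_invariant.
move=> K; apply: vietoris_cvg => V oV.
  by move=> piV; exact: iter_hutchinson_sub_open.
move=> [_ [[alpha _ <-] Vpi]]; have [C [KC wC]] := ex_invariant K.
apply: filterS (near_word_image_sub wC oV Vpi) => k CV /=.
have [y Ky] := @hset_neq0 _ K.
(* The iterate is met along the code of the given point of [V]. *)
exists (word_map w (truncation alpha k) y); split; last first.
  by apply: CV; exists y => //; exact: KC.
apply/iter_hutchinsonP; exists (truncation alpha k); first exact: size_mkseq.
by exists y.
Qed.

Lemma word_images_cvg K alpha :
  himage (word_map w (truncation alpha k)) K @[k --> \oo] --> hpoint (pi alpha).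
Proof.
have [C [KC wC]] := ex_invariant K.
have KV V : open V -> V (pi alpha) ->
    \forall k \near \oo, himage (word_map w (truncation alpha k)) K `<=` V.
  move=> oV Vpi; apply: filterS (near_word_image_sub wC oV Vpi) => k CV.
  by apply: subset_trans CV; exact: image_subset.
apply: vietoris_cvg => V oV; first by move=> Vpi; apply: KV => //; exact: Vpi.
(* A nonempty set contained in [V] meets [V], so the upper half yields the lower one. *)
move=> [_ [-> Vpi]]; apply: filterS (KV V oV Vpi) => k sub_V /=.
have [y y_in] := @hset_neq0 _ (himage (word_map w (truncation alpha k)) K).
by exists y; split=> //; exact: sub_V.
Qed.

(** * Fixed points of word maps *)

Lemma iter_word_fixed s x k : word_map w s x = x ->
  hset (iter (size s * k) (hutchinson w) (hpoint x)) x.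
Proof.
move=> sx; apply/iter_hutchinsonP; exists (flatten (nseq k s)).
  by rewrite size_flatten /shape map_nseq sumn_nseq.
by exists x => //; elim: k => //= k IH; rewrite word_map_cat IH.
Qed.

(** If [x] were outside the range, the complement of [x] would be an open set absorbing all late
    iterates of the singleton, yet [x] recurs at every multiple of [size s]. *)
Lemma word_fixed_in_range s x : s <> [::] -> word_map w s x = x -> range pi x.
Proof.
move=> s0 sx; apply: contrapT => pix.
have oV : open (~` [set x]).
  by apply: closed_openC; exact/accessible_closed_set1/hausdorff_accessible.
have [k _ kV] : \forall k \near \oo,
    iter k (hutchinson w) (hpoint x) `<=` ~` [set x].
  by apply: iter_hutchinson_sub_open => // y piy /= yx; apply: pix; rewrite -yx.
have /kV/(_ x (iter_word_fixed k sx)) : (k <= size s * k)%N by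
  rewrite leq_pmull// lt0n size_eq0; exact/eqP.
exact.
Qed.

Lemma code_range_closure_fixed : range pi =
  closure [set x | exists s, s <> [::] /\ word_map w s x = x].
Proof.
apply/seteqP; split; last first.
  rewrite [X in _ `<=` X](closure_id _).1; last first.
    by apply: compact_closed => //; exact: code_range_compact.
  by apply: closureS => x [s [s0 sx]]; exact: word_fixed_in_range sx.
move=> _ [alpha _ <-] U; rewrite nbhsE => -[V [oV Vpi] VU].
have [C [_ wC]] := ex_invariant (hpoint (pi alpha)).
have [k _ CV] := near_word_image_sub wC oV Vpi.
(* Length [k.+1] makes the word nonempty while its image of [C] still lies in [V]; the fixed point
   with code [s s s ...] lies in that image. *)
set s := truncation alpha k.+1.
have s0 : s <> [::] by [].
exists (pi (periodic_word s)); split.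
  by exists s; split=> //; rewrite word_map_code prepend_periodic.
apply/VU/(CV k.+1); first exact: leqnSn.
rewrite -/s -(prepend_periodic s0) -word_map_code.
by exists (pi (periodic_word s)) => //; exact: code_in_invariant.
Qed.

Lemma code_range_metrizable (R : realType) : metrizable R (set_type (range pi)).
Proof.
have wA : hutchinson w code_range `<=` code_range.
  by rewrite code_range_invariant.
pose K (s : seq 'I_n.+1) : set (set_type (range pi)) :=
  \val @^-1` (word_map w s @` code_range).
apply: (@compact_network_metrizable R _ _ K).
(* The subspace is compact as the image of the code space under [pi] corestricted to its range. *)
- pose g (alpha : code_space n) : set_type (range pi) :=
    exist _ (pi alpha) (mem_set (imageT pi alpha)).
  have -> : [set: set_type (range pi)] = range g.
    apply/seteqP; split=> // -[x xA] _; have [alpha _ pix] := set_mem xA.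
    by exists alpha => //; exact/val_inj.
  apply: continuous_compact; last exact: code_space_compact.
  apply: continuous_subspaceT; apply/continuous_comp_initial.
  exact: code_continuous.
- exact: set_type_hausdorff.
- move=> s; apply: preimage_closed => [x _|].
    exact: (@initial_continuous _ X set_val x).
  by apply: compact_closed => //; exact: compact_image.
move=> [x xA] [y yA]; have [alpha _ pix] := set_mem xA.
have [beta _ piy] := set_mem yA; subst x y => xy.
have /eqP pi_neq : pi alpha <> pi beta by move=> e; apply/xy/val_inj.
(* Long truncations of the two codes give word images inside disjoint open sets, hence a disjoint
   pair of the network. *)
have := X_hausdorff; rewrite open_hausdorff => /(_ _ _ pi_neq).
move=> [[U V] /= [/set_mem Ux /set_mem Vy] [oU oV /eqP UV]].
have [k _ kU] := near_word_image_sub wA oU Ux.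
have [m _ mV] := near_word_image_sub wA oV Vy.
exists (truncation alpha k), (truncation beta m); split.
- exact: code_in_word_image.
- exact: code_in_word_image.
apply/seteqP; split=> // z [/(kU k (leqnn k)) Uz /(mV m (leqnn m)) Vz].
by have : (U `&` V) (\val z) by []; rewrite UV.
Qed.

End coding_map.
End ifs.

Theorem theorem3p7 (R : realType) (X : topologicalType)
  (X_neq0 : [set: X] !=set0) (X_hausdorff : hausdorff_space X)
  (n : nat) (w : 'I_n.+1 -> continuousType X X) (w_tifs : tifs w) :
  exists pi : code_space n -> X,
    (continuous pi /\
       forall i : 'I_n.+1, w i \o pi = pi \o shift_in i) /\
    (exists A : hyperspace X, range pi = A /\ is_attractor w A) /\
    (forall (alpha : code_space n) (C : hyperspace X),
       hutchinson w C `<=` C ->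
       \bigcap_k (word_map w (truncation alpha k) @` C) = [set pi alpha]) /\
    (forall (K : hyperspace X) (alpha : code_space n),
       himage (word_map w (truncation alpha k)) K @[k --> \oo]
         --> hpoint (pi alpha)) /\
    range pi = closure [set x : X | exists s : seq 'I_n.+1,
                                      s <> [::] /\ word_map w s x = x] /\
    metrizable R (set_type (range pi)).

Proof.
have [pi piP] := tifs_code w_tifs X_neq0; have [ex_invariant _] := w_tifs.
exists pi; split; [split|split; [|split; [|split; [|split]]]].
- exact: code_continuous piP.
- by move=> i; apply/funext => alpha; exact: code_shift_in piP i alpha.
- exists (code_range X_hausdorff ex_invariant piP); split=> //.
  exact: code_range_attractor.
- exact: piP.
- exact: word_images_cvg piP.
- exact: code_range_closure_fixed piP.
- exact: code_range_metrizable piP R.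
Qed.
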